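(* Let $n\ge 1$, $m,\ell\ge 0$ be integers, let $C,A_1,\dots,A_{m+\ell}$ be Hermitian $n\times n$ matrices and $b\in\mathbb{R}^{m+\ell}$, and consider the primal-dual pair of semidefinite programs (P), (D) with this data. Suppose that (P), (D) satisfy the Slater condition, that strict complementarity holds between any pair of primal-dual optimal solutions, and that $A_1,\dots,A_m$ are linearly independent. Let $X^\circ\in\mathcal{P}^\circ$ be a primal optimal solution that is primal nondegenerate. If $m+a(X^\circ)\ge 2n$, then $\operatorname{rank}(X)>1$ for all $X\in\mathcal{P}^\circ$.
   Context: Let $\mathcal{H}^n$ be the real vector space (dimension $n^2$) of Hermitian $n\times n$ complex matrices, with inner product $A\bullet B=\sum_{i,j}a_{ij}\overline{b_{ij}}$; linear independence of Hermitian matrices is over $\mathbb{R}$. $A\succeq 0$ ($A\succ 0$) means $A$ is Hermitian positive semidefinite (definite). (P): minimize $C\bullet X$ over $X\in\mathcal{H}^n$ subject to $A_k\bullet X=b_k$ for $k\in\mathcal{E}:=\{1,\dots,m\}$, $A_k\bullet X\le b_k$ for $k\in\mathcal{I}:=\{m+1,\dots,m+\ell\}$, and $X\succeq 0$. (D): maximize $-b^\top y$ over $y\in\mathbb{R}^{m+\ell}$ subject to $Z(y):=C+\sum_{k=1}^{m+\ell}y_kA_k\succeq 0$ and $y_k\ge 0$ for $k\in\mathcal{I}$. $\mathcal{P},\mathcal{D}$ denote the feasible sets and $\mathcal{P}^\circ,\mathcal{D}^\circ$ the sets of optimal solutions of (P), (D). For $X\in\mathcal{P}$, $\mathcal{A}(X):=\{k\in\mathcal{I}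 : A_k\bullet X=b_k\}$ and $a(X):=|\mathcal{A}(X)|$. Slater condition: there is $X\in\mathcal{P}$ with $X\succ 0$ and $A_k\bullet X<b_k$ for all $k\in\mathcal{I}$, and there is $y\in\mathcal{D}$ with $Z(y)\succ 0$ and $y_k>0$ for all $k\in\mathcal{I}$. Strict complementarity for $(X,y)\in\mathcal{P}^\circ\times\mathcal{D}^\circ$: $\operatorname{rank}(X)+\operatorname{rank}(Z(y))=n$. Primal nondegeneracy: let $X\in\mathcal{P}$ have rank $r$ and eigenvalue decomposition $X=Q\Lambda Q^*$ with $Q$ unitary and $\Lambda=\operatorname{diag}(\lambda_1,\dots,\lambda_r,0,\dots,0)$, $\lambda_1,\dots,\lambda_r>0$. Partition $Q=[Q_1\ Q_2]$ with $Q_1\in\mathbb{C}^{n\times r}$, $Q_2\in\mathbb{C}^{n\times(n-r)}$. Then $X$ is primal nondegenerate if and only if the matrices $$B_k^p:=\begin{bmatrix}Q_1^*A_kQ_1 & Q_1^*A_kQ_2\\ Q_2^*A_kQ_1 & 0\end{bmatrix},\qquad k\in\mathcal{E}\cup\mathcal{A}(X),$$ (as a family indexed by $k$) are linearly independent in $\mathcal{H}^n$. *)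

(* Defs.v *)
From mathcomp Require Import all_boot all_order all_algebra.
From mathcomp Require Import spectral complex classical_sets reals.

Set Implicit Arguments.
Unset Strict Implicit.
Unset Printing Implicit Defensive.

Import Order.TTheory GRing.Theory Num.Theory.

Local Open Scope complex_scope.
Local Open Scope sesquilinear_scope.
Local Open Scope classical_set_scope.
Local Open Scope ring_scope.

(* The order of [R[i]] is the partial order in which [z <= w] means that
   [w - z] is a nonnegative real.  Inner products and quadratic forms of
   Hermitian matrices are real, so comparing them in [R[i]] amounts to
   comparing them in [R]. *)

Section HermitianMatrices.
Variables (R : realType) (n : nat).
Implicit Types A B X : 'M[R[i]]_n.

Definition inner A B : R[i] := \sum_i \sum_j A i j * (B i j)^*.

Definition psd A : Prop :=
  A \is hermsymmx /\ forall x : 'cV[R[i]]_n, 0 <= (x ^t* *m A *m x) 0 0.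

Definition pd A : Prop :=
  A \is hermsymmx /\
  forall x : 'cV[R[i]]_n, x != 0 -> 0 < (x ^t* *m A *m x) 0 0.

End HermitianMatrices.

(* Independence over the reals of the family [(B k)], [k] in [K]: the scalars
   range over [R], not over [R[i]], and repeated matrices are dependent. *)
Definition lin_indep (R : realType) (n : nat) (I : finType) (K : {set I})
    (B : I -> 'M[R[i]]_n) : Prop :=
  forall c : I -> R, \sum_(k in K) (c k)%:C *: B k = 0 ->
  forall k, k \in K -> c k = 0.

Section SemidefiniteProgram.
Variables (R : realType) (n m l : nat).
Variables (C : 'M[R[i]]_n) (A : 'I_(m + l) -> 'M[R[i]]_n) (b : 'cV[R]_(m + l)).
Implicit Types (X : 'M[R[i]]_n) (y : 'cV[R]_(m + l)).

Definition eq_idx : {set 'I_(m + l)} := [set k : 'I_(m + l) | (k < m)%N]%SET.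
Definition ineq_idx : {set 'I_(m + l)} := [set k : 'I_(m + l) | (m <= k)%N]%SET.

Definition primal_feasible : set 'M[R[i]]_n :=
  [set X | [/\ psd X,
     forall k, k \in eq_idx -> inner (A k) X = (b k 0)%:C
   & forall k, k \in ineq_idx -> inner (A k) X <= (b k 0)%:C]].

Definition primal_optimal : set 'M[R[i]]_n :=
  [set X | primal_feasible X /\
     forall X', primal_feasible X' -> inner C X <= inner C X'].

Definition slack y : 'M[R[i]]_n := C + \sum_k (y k 0)%:C *: A k.

Definition dual_obj y : R := - \sum_k b k 0 * y k 0.

Definition dual_feasible : set 'cV[R]_(m + l) :=
  [set y | psd (slack y) /\ forall k, k \in ineq_idx -> 0 <= y k 0].

Definition dual_optimal : set 'cV[R]_(m + l) :=
  [set y | dual_feasible y /\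
     forall y', dual_feasible y' -> dual_obj y' <= dual_obj y].

Definition active X : {set 'I_(m + l)} :=
  [set k in ineq_idx | inner (A k) X == (b k 0)%:C]%SET.

Definition slater : Prop :=
  (exists X, [/\ primal_feasible X, pd X
     & forall k, k \in ineq_idx -> inner (A k) X < (b k 0)%:C]) /\
  (exists y, [/\ dual_feasible y, pd (slack y)
     & forall k, k \in ineq_idx -> 0 < y k 0]).

Definition strict_complementary X y : Prop :=
  (\rank X + \rank (slack y) = n)%N.

(* [X = Q Lambda Q^*] with [Q = [Q1 Q2]]; when [r <= n] the matrix
   [row_mx Q1 Q2] is square, so [unitarymx] has its usual meaning. *)
Definition eig_decomp X (r : nat) (Q1 : 'M[R[i]]_(n, r))
    (Q2 : 'M[R[i]]_(n, n - r)) (lam : 'rV[R]_r) : Prop :=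
  [/\ row_mx Q1 Q2 \is unitarymx, forall i, 0 < lam 0 i
   & X = row_mx Q1 Q2
           *m block_mx (diag_mx (map_mx (real_complex R) lam)) 0 0 0
           *m (row_mx Q1 Q2) ^t*].

Definition Bp (r : nat) (Q1 : 'M[R[i]]_(n, r)) (Q2 : 'M[R[i]]_(n, n - r))
    (k : 'I_(m + l)) : 'M[R[i]]_(r + (n - r)) :=
  block_mx (Q1 ^t* *m A k *m Q1) (Q1 ^t* *m A k *m Q2)
           (Q2 ^t* *m A k *m Q1) 0.

(* Every feasible [X] has such a decomposition, and the independence of the
   [Bp Q1 Q2 k] does not depend on its choice. *)
Definition primal_nondegenerate X : Prop :=
  exists r (Q1 : 'M[R[i]]_(n, r)) (Q2 : 'M[R[i]]_(n, n - r)) (lam : 'rV[R]_r),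
    [/\ \rank X = r, eig_decomp X Q1 Q2 lam
      & lin_indep (eq_idx :|: active X)%SET (Bp Q1 Q2)].

End SemidefiniteProgram.

Arguments eq_idx {m l}.
Arguments ineq_idx {m l}.

(* Main.v *)
Require Import Defs.
From mathcomp Require Import all_boot all_order all_algebra.
From mathcomp Require Import sesquilinear spectral complex boolp classical_sets functions.
From mathcomp Require Import reals filter topology normedtype derive.

Set Implicit Arguments.
Unset Strict Implicit.
Unset Printing Implicit Defensive.

Import Order.TTheory GRing.Theory Num.Theory.
Local Open Scope ring_scope.

(* Strict complementarity gives [\rank X + \rank (slack y) = n] for every primal
   optimal [X] and a fixed dual optimal [y], so all primal optimal solutions
   have the same rank, provided that a dual optimal [y] exists.  The matrices
   [Bp Q1 Q2 k] of a nondegenerate [X0] of rank [r] are Hermitian with a zero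
   block of size [n - r], so they live in a real space of dimension [2nr - r^2],
   which is below [2n] when [r <= 1]; hence [X0] has rank at least 2.

   For the existence of [y], the dual feasible set is an intersection of
   half-spaces.  Let [d] be a recession direction of it along which the objective
   does not decrease, and [X] a Slater point.  Pairing [slack 0 A d] with [X]
   gives [slack 0 A d = 0] and [d k = 0] on the inequality indices, so [d = 0]
   by independence of the equality constraints.  A superlevel set of the dual is
   then compact. *)

(** * Intersections of half-spaces: boundedness and attained maxima *)

Section HalfSpaces.
Import numFieldTopology.Exports numFieldNormedType.Exports.
Local Open Scope classical_set_scope.
Variables (R : realType) (N : nat).

Lemma continuous_mulmx_cV (a : 'cV[R]_N) :
  continuous (fun y : 'rV[R]_N => (y *m a) 0 0).
Proof.
have -> : (fun y : 'rV[R]_N => (y *m a) 0 0) =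
    (fun y => \sum_(k <- index_enum 'I_N) y 0 k * a k 0).
  by apply/funext => y; rewrite mxE.
(* Induction runs over an arbitrary index list, so continuity follows from that of sums and
   coordinates. *)
elim: (index_enum _) => [|k s IH].
  have -> : (fun y : 'rV[R]_N => \sum_(k <- [::]) y 0 k * a k 0) = fun=> 0.
    by apply/funext => y; rewrite big_nil.
  exact: cst_continuous.
have -> : (fun y : 'rV[R]_N => \sum_(k <- k :: s) y 0 k * a k 0) =
    (fun y : 'rV[R]_N => y 0 k * a k 0) +
    (fun y : 'rV[R]_N => \sum_(k <- s) y 0 k * a k 0).
  by apply/funext => y; rewrite big_cons.
move=> y; apply: continuousD (IH y).
by apply: (cvgMr_tmp (F := nbhs y)); exact: coord_continuous.
Qed.

Lemma closed_half_space (a : 'cV[R]_N) (c : R) :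
  closed [set y : 'rV[R]_N | c <= (y *m a) 0 0].
Proof.
apply: (@preimage_closed _ R (fun y : 'rV[R]_N => (y *m a) 0 0) [set x | c <= x]).
  by move=> y _; exact: continuous_mulmx_cV.
exact: closed_ge.
Qed.

(* If the points [y j] escape to infinity, any cluster point of their
   normalizations is a nonzero recession direction. *)
Lemma half_spaces_bounded (T : Type) (a : T -> 'cV[R]_N) (c : T -> R) :
    (forall d : 'rV[R]_N, (forall t, 0 <= (d *m a t) 0 0) -> d = 0) ->
  bounded_set [set y : 'rV[R]_N | forall t, c t <= (y *m a t) 0 0].
Proof.
move=> recession0; pose K := [set y : 'rV[R]_N | forall t, c t <= (y *m a t) 0 0].
apply/not_notP => unbK.
have {unbK} /choice[y yP] (j : nat) : exists y, K y /\ j.+1%:R < `|y|.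
  apply/not_notP => noy; apply: unbK; exists j.+1%:R; split=> [|M ltM y Ky].
    exact: realn.
  apply/ltW/(le_lt_trans _ ltM); rewrite leNgt; apply/negP => lty.
  by apply: noy; exists y.
have y0 j : 0 < `|y j| by apply: lt_trans (proj2 (yP j)); rewrite ltr0n.
pose d j := `|y j|^-1 *: y j.
have d1 j : `|d j| = 1.
  by rewrite normrZ normfV normr_id mulVf ?gt_eqF.
(* The unit sphere of a finite-dimensional space is compact, so the directions [d j] have a cluster
   point [z] of norm 1. *)
have sphere_compact : compact [set z : 'rV[R]_N | `|z| = 1].
  apply: bounded_closed_compact.
    by exists 1; split=> [|M /ltW leM z /= ->//]; exact: real1.
  apply: (@preimage_closed _ R (fun z : 'rV[R]_N => `|z|) [set 1]).
    by move=> z _; exact: norm_continuous.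
  exact: closed_eq.
have [|z [/= z1 zcl]] := sphere_compact (d @ \oo) _.
  by exists 0%N => // j _ /=; exact: d1.
suff zrec : forall t, 0 <= (z *m a t) 0 0.
  by move: z1; rewrite (recession0 z zrec) normr0 => /esym/eqP; rewrite oner_eq0.
(* It suffices to bound the pairing of [z] below by [- e] for each [e > 0]; this closed condition
   passes to [z] once it holds for all large [j]. *)
move=> t; apply/ler_addgt0Pr => e e0; rewrite -lerBlDr sub0r.
apply: (closed_half_space (a := a t) (c := - e)).
move=> U /zcl; apply => /=.
(* Pairing [d j] with [a t] gives at least [c t / |y j|], which exceeds [- e] as soon as
   [|y j| > - c t / e]. *)
have [M cM] : exists M : nat, - c t / e < M%:R.
  by exists (Num.truncn (- c t / e)).+1; exact: truncnS_gt.
exists M => // j /= Mj; rewrite -scalemxAl mxE.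
have [Kj jlt] := yP j.
rewrite -ler_pdivrMl ?invr_gt0// invrK; apply: le_trans (Kj t).
rewrite mulrN lerNl; apply/ltW.
rewrite -ltr_pdivrMr//; apply/(lt_trans cM)/(le_lt_trans _ jlt).
by rewrite ler_nat ltnW.
Qed.

(** Adding the superlevel half-space of [f] at a known feasible point, under the index [None],
    leaves no nonzero recession direction. The truncated set is compact and still meets every better
    point. *)
Lemma half_spaces_argmax (T : Type) (a : T -> 'cV[R]_N) (c : T -> R) (f : 'cV[R]_N) :
    (exists y : 'rV[R]_N, forall t, c t <= (y *m a t) 0 0) ->
    (forall d : 'rV[R]_N, (forall t, 0 <= (d *m a t) 0 0) ->
       0 <= (d *m f) 0 0 -> d = 0) ->
  exists y : 'rV[R]_N, (forall t, c t <= (y *m a t) 0 0) /\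
    forall y' : 'rV[R]_N, (forall t, c t <= (y' *m a t) 0 0) ->
      (y' *m f) 0 0 <= (y *m f) 0 0.
Proof.
move=> [y0 y0P] recession0.
pose a' (t : option T) := if t is Some t then a t else f.
pose c' (t : option T) := if t is Some t then c t else (y0 *m f) 0 0.
pose K := [set y : 'rV[R]_N | forall t, c' t <= (y *m a' t) 0 0].
have y0K : K y0 by case=> [t|] /=.
have K_bounded : bounded_set K.
  apply: half_spaces_bounded => d dP; apply: recession0 => [t|].
    exact: (dP (Some t)).
  exact: (dP None).
have K_closed : closed K.
  have -> : K = \bigcap_t [set y | c' t <= (y *m a' t) 0 0].
    by apply/seteqP; split=> y yP t; [move=> _|]; apply: yP.
  by apply: closed_bigI => t _; exact: closed_half_space.
have [|||y yK ymax] := @EVT_max_rV R N (fun y => (y *m f) 0 0) K.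
- by exists y0.
- exact: bounded_closed_compact.
- by apply: continuous_subspaceT; exact: continuous_mulmx_cV.
rewrite inE in yK; exists y; split=> [t|y' y'P]; first exact: (yK (Some t)).
(* A point [y'] outside the superlevel set is already beaten by [y0]. *)
have [le_y0|/ltW y0_le] := leP ((y' *m f) 0 0) ((y0 *m f) 0 0).
  exact: le_trans le_y0 (yK None).
by apply: ymax; rewrite inE => -[t|] /=.
Qed.

End HalfSpaces.

(** * Real and imaginary parts *)

Section ComplexParts.
Local Open Scope complex_scope.
Local Open Scope ring_scope.
Variable R : realType.
Implicit Types (x : R) (z : R[i]).

Lemma Re_sum (I : Type) (s : seq I) (P : pred I) (F : I -> R[i]) :
  complex.Re (\sum_(k <- s | P k) F k) = \sum_(k <- s | P k) complex.Re (F k).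
Proof. by apply: (big_morph (@complex.Re R)) => // -[? ?] [? ?]. Qed.

Lemma Im_sum (I : Type) (s : seq I) (P : pred I) (F : I -> R[i]) :
  complex.Im (\sum_(k <- s | P k) F k) = \sum_(k <- s | P k) complex.Im (F k).
Proof. by apply: (big_morph (@complex.Im R)) => // -[? ?] [? ?]. Qed.

Lemma Re_mul_real x z : complex.Re (x%:C * z) = x * complex.Re z.
Proof. by case: z => a b /=; rewrite mul0r subr0. Qed.

Lemma Im_mul_real x z : complex.Im (x%:C * z) = x * complex.Im z.
Proof. by case: z => a b /=; rewrite mul0r addr0. Qed.

Lemma conjC_real x : (x%:C : R[i])^* = x%:C.
Proof. exact: conjc_real. Qed.

Lemma conjC_fixed_real z : z^* = z -> z = (complex.Re z)%:C.
Proof. by move=> zJ; rewrite RRe_real//; apply/CrealP. Qed.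

Lemma Re_conjC z : complex.Re z^* = complex.Re z. Proof. by case: z. Qed.
Lemma Im_conjC z : complex.Im z^* = - complex.Im z. Proof. by case: z. Qed.

Lemma complex_eq0 z : complex.Re z = 0 -> complex.Im z = 0 -> z = 0.
Proof. by case: z => a b /= -> ->. Qed.

End ComplexParts.

(** * Hermitian matrices and conjugate transposes *)

Section Hermitian.
Local Open Scope sesquilinear_scope.
Local Open Scope ring_scope.
Variable C : numClosedFieldType.

Lemma hermsymmxP n (A : 'M[C]_n) : A \is hermsymmx <-> A ^t* = A.
Proof.
by split=> [/is_hermitianmxP|AJ]; last apply/is_hermitianmxP;
   rewrite expr0 scale1r.
Qed.

Lemma trmxC_mul m n p (A : 'M[C]_(m, n)) (B : 'M[C]_(n, p)) :
  (A *m B) ^t* = B ^t* *m A ^t*.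
Proof. by rewrite trmx_mul map_mxM. Qed.

Lemma hermsymmx_entry n (A : 'M[C]_n) i j : A \is hermsymmx -> (A i j)^* = A j i.
Proof. by move=> /hermsymmxP AJ; rewrite -{2}AJ !mxE. Qed.

End Hermitian.

Section RealCombination.
Local Open Scope complex_scope.
Local Open Scope ring_scope.
Variable R : realType.

Lemma sum_real_herm (n : nat) (I : finType) (P : pred I) (c : I -> R) (B : I -> 'M[R[i]]_n) :
  (forall k, B k \is hermsymmx) -> \sum_(k | P k) (c k)%:C *: B k \is hermsymmx.
Proof.
move=> Bherm; apply/hermsymmxP; apply/matrixP => i j; rewrite !mxE !summxE rmorph_sum.
by apply: eq_bigr => k _; rewrite !mxE rmorphM [LHS]/= conjC_real hermsymmx_entry.
Qed.

End RealCombination.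

(** * Quadratic forms and the trace inner product *)

Section Quadratic.
Local Open Scope complex_scope.
Local Open Scope sesquilinear_scope.
Local Open Scope ring_scope.
Variables (R : realType) (n : nat).
Implicit Types (A B X : 'M[R[i]]_n) (x : 'cV[R[i]]_n).

Definition qform A x : R[i] := (x ^t* *m A *m x) 0 0.

Lemma qform_herm A x : A \is hermsymmx -> qform A x = (complex.Re (qform A x))%:C.
Proof.
move=> /hermsymmxP AJ; apply: conjC_fixed_real; rewrite /qform.
have <- : (x ^t* *m A *m x) ^t* 0 0 = ((x ^t* *m A *m x) 0 0)^* by rewrite !mxE.
by rewrite !trmxC_mul AJ trmxCK mulmxA.
Qed.

Lemma qform_row (U : 'M[R[i]]_n) A i :
  qform A ((row i U) ^t*) = (U *m A *m U ^t*) i i.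
Proof.
rewrite /qform trmxCK -row_mul 2!mxE.
by apply: eq_bigr => j _; rewrite !mxE.
Qed.

Lemma inner_trace A B : inner A B = \tr (A *m B ^t*).
Proof.
rewrite /inner /mxtrace; apply: eq_bigr => i _; rewrite mxE.
by apply: eq_bigr => j _; rewrite !mxE.
Qed.

Lemma inner_sum_real (I : finType) (P : pred I) (c : I -> R) (B : I -> 'M_n) X :
  inner (\sum_(k | P k) (c k)%:C *: B k) X = \sum_(k | P k) (c k)%:C * inner (B k) X.
Proof.
rewrite inner_trace mulmx_suml raddf_sum; apply: eq_bigr => k _ /=.
by rewrite -scalemxAl mxtraceZ inner_trace.
Qed.

Lemma spectral_psd A i : psd A -> 0 <= spectral_diag A 0 i.
Proof.
move=> [Aherm Apos]; have /hermitian_normalmx/orthomx_spectralP A_eq := Aherm.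
have U_unitary := spectral_unitarymx A.
have := Apos ((row i (spectralmx A)) ^t*).
rewrite -/(qform _ _) qform_row {2}A_eq invmx_unitary//.
have /unitarymxP UU := U_unitary.
rewrite -!mulmxA UU mulmx1 mulmxA UU mul1mx.
by rewrite mxE eqxx mulr1n.
Qed.

(** In an eigenbasis of [A], [inner A X] is the sum of the nonnegative eigenvalues of [A] weighted
    by the positive diagonal entries of [X], so every eigenvalue vanishes. *)
Lemma inner_psd_pd_eq0 A X : psd A -> pd X -> inner A X <= 0 -> A = 0.
Proof.
move=> Apsd [/hermsymmxP XJ Xpos] AX.
have [Aherm _] := Apsd.
have /hermitian_normalmx/orthomx_spectralP A_eq := Aherm.
set U := spectralmx A in A_eq; set sp := spectral_diag A in A_eq.
have U_unitary : U \is unitarymx := spectral_unitarymx A.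
have U_unit := unitarymx_unit U_unitary.
(* These entries are values of the quadratic form of [X] at the conjugated rows of [U], nonzero
   since [U] is invertible. *)
have Xi i : 0 < (U *m X *m U ^t*) i i.
  rewrite -qform_row; apply: Xpos; apply/eqP => Ui0.
  have : row i U = 0 by rewrite -[row i U]trmxCK Ui0 trmx0 map_mx0.
  rewrite rowE => /(congr1 (mulmx^~ (invmx U))); rewrite mulmxK// mul0mx.
  by move/matrixP/(_ 0 i); rewrite !mxE !eqxx => /eqP; rewrite oner_eq0.
have innerE : inner A X = \sum_i sp 0 i * (U *m X *m U ^t*) i i.
  rewrite inner_trace XJ {1}A_eq invmx_unitary//.
  rewrite -!mulmxA mxtrace_mulC -!mulmxA /mxtrace.
  by apply: eq_bigr => i _; rewrite mul_diag_mx [LHS]mxE.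
have sp0 i : sp 0 i = 0.
  have term_ge0 j : 0 <= sp 0 j * (U *m X *m U ^t*) j j.
    by rewrite mulr_ge0// ?spectral_psd// ltW.
  have : \sum_j sp 0 j * (U *m X *m U ^t*) j j == 0.
    by rewrite eq_le -innerE AX innerE sumr_ge0.
  rewrite psumr_eq0// => /allP/(_ i (mem_index_enum _)).
  by rewrite /= mulf_eq0 (gt_eqF (Xi i)) orbF => /eqP.
rewrite A_eq (_ : diag_mx sp = 0) ?mulmx0 ?mul0mx//.
by apply/matrixP => i j; rewrite !mxE sp0 mul0rn.
Qed.

End Quadratic.

Lemma mul_delta_cV (K : pzSemiRingType) (N : nat) (y : 'cV[K]_N) k :
  (y^T *m delta_mx k (0 : 'I_1)) 0 0 = y k 0.
Proof. by rewrite -colE !mxE. Qed.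

(** * Semidefiniteness of the slack matrix as linear inequalities in [y] *)

Section SlackHalfSpaces.
Variables (R : realType) (n m l : nat).
Variables (C : 'M[R[i]]_n) (A : 'I_(m + l) -> 'M[R[i]]_n).
Hypotheses (hC : C \is hermsymmx) (hA : forall k, A k \is hermsymmx).

Lemma slack_herm y : slack C A y \is hermsymmx.
Proof.
apply/hermsymmxP; rewrite /slack !linearD /= map_mxD.
by congr (_ + _); apply/hermsymmxP => //; exact: sum_real_herm.
Qed.

(** This is the gradient in [y] of the quadratic form of [slack C A y] at [x]. *)
Definition qcoef (x : 'cV[R[i]]_n) : 'cV[R]_(m + l) :=
  \col_k complex.Re (qform (A k) x).

Lemma Re_qform_slack y x :
  complex.Re (qform (slack C A y) x) =
  complex.Re (qform C x) + (y^T *m qcoef x) 0 0.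
Proof.
rewrite /qform /slack mulmxDr mulmxDl mxE raddfD/=; congr (_ + _).
rewrite mulmx_sumr mulmx_suml summxE Re_sum [RHS]mxE; apply: eq_bigr => k _.
by rewrite -scalemxAr -scalemxAl !mxE Re_mul_real /qform mxE.
Qed.

Lemma psd_slackP y :
  psd (slack C A y) <->
  forall x, - complex.Re (qform C x) <= (y^T *m qcoef x) 0 0.
Proof.
have nonnegP x : (0 <= qform (slack C A y) x) =
    (- complex.Re (qform C x) <= (y^T *m qcoef x) 0 0).
  by rewrite qform_herm ?slack_herm// ler0c Re_qform_slack -lerBlDl sub0r.
split=> [[_ pos] x|pos]; first by rewrite -nonnegP; exact: pos.
by split=> [|x]; [exact: slack_herm | rewrite -/(qform _ _) nonnegP].
Qed.

End SlackHalfSpaces.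

(** * Existence of a dual optimal solution *)

Section DualAttainment.
Local Open Scope complex_scope.
Local Open Scope ring_scope.
Variables (R : realType) (n m l : nat).
Variables (C : 'M[R[i]]_n) (A : 'I_(m + l) -> 'M[R[i]]_n) (b : 'cV[R]_(m + l)).
Hypotheses (hC : C \is hermsymmx) (hA : forall k, A k \is hermsymmx).

Lemma dual_recession0 X (d : 'cV[R]_(m + l)) :
    lin_indep eq_idx A -> primal_feasible A b X -> pd X ->
    (forall k, k \in ineq_idx -> inner (A k) X < (b k 0)%:C) ->
    psd (slack 0 A d) -> (forall k, k \in ineq_idx -> 0 <= d k 0) ->
    \sum_k b k 0 * d k 0 <= 0 ->
  d = 0.
Proof.
move=> indep [_ Xeq Xineq] Xpd Xlt Dpsd d_ge0 bd.
pose g k := complex.Re (inner (A k) X).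
have eq_or_ineq k : k \in ineq_idx = (k \notin eq_idx).
  by rewrite !inE leqNgt.
(* On inequality indices the pairing is real because [<=] in [R[i]] forces equal imaginary parts. *)
have gE k : inner (A k) X = (g k)%:C.
  rewrite /g; have [kE|] := boolP (k \in eq_idx); first by rewrite Xeq.
  rewrite -eq_or_ineq => /Xineq.
  by case: (inner _ _) => u v; rewrite lecE /= => /andP[/eqP <- _].
have geq k : k \in eq_idx -> g k = b k 0 by move=> /Xeq; rewrite gE => /complexI.
have glt k : k \in ineq_idx -> g k < b k 0.
  by move=> /Xlt; rewrite gE ltcR.
have term_ge0 k : 0 <= d k 0 * (b k 0 - g k).
  have [kE|] := boolP (k \in eq_idx); first by rewrite geq// subrr mulr0.
  by rewrite -eq_or_ineq => kI; rewrite mulr_ge0 ?d_ge0// subr_ge0 ltW ?glt.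
have DX : inner (slack 0 A d) X = (\sum_k d k 0 * g k)%:C.
  rewrite /slack add0r inner_sum_real rmorph_sum; apply: eq_bigr => k _.
  by rewrite gE rmorphM.
(* The left side is nonnegative, so [bd] makes the pairing of [slack 0 A d] with [X] nonpositive.
   Once that pairing is known to vanish, the same identity makes each term on the left zero. *)
have gap : \sum_k d k 0 * (b k 0 - g k) =
    \sum_k b k 0 * d k 0 - \sum_k d k 0 * g k.
  by rewrite -sumrB; apply: eq_bigr => k _; rewrite mulrBr mulrC.
have D0 : slack 0 A d = 0.
  apply: inner_psd_pd_eq0 Dpsd Xpd _; rewrite DX lecR.
  apply: le_trans bd; rewrite -subr_ge0 -gap; exact: sumr_ge0.
have dg0 : \sum_k d k 0 * g k = 0.
  by apply: complexI; rewrite -DX D0 inner_trace mul0mx linear0.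
have dI k : k \in ineq_idx -> d k 0 = 0.
  move=> kI; have : \sum_k d k 0 * (b k 0 - g k) == 0.
    by rewrite eq_le sumr_ge0// andbT gap dg0 subr0.
  rewrite psumr_eq0// => /allP/(_ k (mem_index_enum _)).
  by rewrite /= mulf_eq0 subr_eq0 (gt_eqF (glt k kI)) orbF => /eqP.
apply/matrixP => k j; rewrite ord1 mxE.
have [kE|] := boolP (k \in eq_idx); last by rewrite -eq_or_ineq => /dI.
apply: (indep (fun k => d k 0)) kE.
rewrite -[RHS]D0 /slack add0r big_mkcond; apply: eq_bigr => i _.
by case: ifPn => //; rewrite -eq_or_ineq => /dI ->; rewrite scale0r.
Qed.

Lemma dual_optimal_exists :
  lin_indep eq_idx A -> slater C A b -> exists y, dual_optimal C A b y.
Proof.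
move=> indep [[X [Xfeas Xpd Xlt]] [y0 [y0feas _ _]]].
(* One half-space for each test vector of the slack matrix and one for each sign constraint. *)
pose T := ('cV[R[i]]_n + {k : 'I_(m + l) | k \in ineq_idx})%type.
pose a (t : T) : 'cV[R]_(m + l) :=
  match t with inl x => qcoef A x | inr k => delta_mx (val k) 0 end.
pose c (t : T) : R :=
  match t with inl x => - complex.Re (qform C x) | inr _ => 0 end.
have feasP y : dual_feasible C A y <-> forall t, c t <= (y^T *m a t) 0 0.
  split=> [[/(psd_slackP hC hA) ypsd y_ge0] [x|[k kI]] /=|yP]; first exact: ypsd.
    by rewrite mul_delta_cV; exact: y_ge0.
  split=> [|k kI]; first by apply/(psd_slackP hC hA) => x; exact: (yP (inl x)).
  by have := yP (inr (exist _ k kI)); rewrite /= mul_delta_cV.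
have objE y : dual_obj b y = (y^T *m (- b)) 0 0.
  rewrite /dual_obj -sumrN mxE; apply: eq_bigr => k _.
  by rewrite !mxE mulrN mulrC.
have [||y [yfeas ymax]] := half_spaces_argmax (a := a) (c := c) (f := - b).
- by exists y0^T; apply/feasP.
- move=> d dP df; apply: trmx_inj; rewrite trmx0.
  apply: (dual_recession0 indep Xfeas Xpd Xlt) => [|k kI|].
  (* Recession directions satisfy the same inequalities with [C] replaced by 0. *)
  + have herm0 : (0 : 'M[R[i]]_n) \is hermsymmx.
      by apply/hermsymmxP; rewrite trmx0 map_mx0.
    apply/(psd_slackP herm0 hA) => x.
    rewrite trmxK /qform mulmx0 mul0mx mxE oppr0; exact: (dP (inl x)).
  + by have := dP (inr (exist _ k kI)); rewrite /= -[d in d *m _]trmxK mul_delta_cV.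
  + by rewrite -oppr_ge0 -/(dual_obj b d^T) objE trmxK.
exists y^T; split=> [|y' /feasP y'feas]; first by apply/feasP => t; rewrite trmxK.
by rewrite !objE trmxK; exact: ymax.
Qed.

End DualAttainment.

(** * Dimension count for the matrices [Bp] *)

Section NondegeneracyCount.
Local Open Scope complex_scope.
Local Open Scope ring_scope.
Variable R : realType.

(** The [e k] act as real coordinates: a combination whose coordinates vanish is zero. Independence
    thus passes to the coordinate rows, which have length [#|J|]. *)
Lemma lin_indep_card (n : nat) (I J : finType) (K : {set I})
    (B : I -> 'M[R[i]]_n) (e : I -> J -> R) :
    (forall c : I -> R, (forall j, \sum_(k in K) c k * e k j = 0) ->
       \sum_(k in K) (c k)%:C *: B k = 0) ->
  lin_indep K B -> (#|K| <= #|J|)%N.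
Proof.
move=> e_sep indep.
pose V : 'M[R]_(#|K|, #|J|) := \matrix_(p, q) e (enum_val p) (enum_val q).
suff : row_free V by rewrite -row_leq_rank => /leq_trans; apply; exact: rank_leq_col.
rewrite -kermx_eq0; apply/rowV0P => u /sub_kermxP uV.
(* [enum_rank_in] needs an element of [K]; an empty [K] gives no coordinates to check. *)
have [K0|[k0 k0K]] := set_0Vmem K.
  by apply/rowP => -[p plt]; exfalso; move: plt; rewrite K0 cards0.
pose c k := u 0 (enum_rank_in k0K k).
have cE (F : I -> R) : \sum_(k in K) c k * F k = \sum_p u 0 p * F (enum_val p).
  rewrite big_enum_val; apply: eq_bigr => p _.
  by rewrite /c enum_valK_in.
have c0 : forall k, k \in K -> c k = 0.
  apply: indep; apply: e_sep => j; rewrite cE.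
  move/rowP/(_ (enum_rank j)): uV; rewrite !mxE => uV.
  by rewrite -[RHS]uV; apply: eq_bigr => p _; rewrite mxE enum_rankK.
apply/rowP => p; rewrite mxE -(enum_valK_in k0K p).
exact/c0/enum_valP.
Qed.

Lemma Bp_herm n m l (A : 'I_(m + l) -> 'M[R[i]]_n) r
    (Q1 : 'M[R[i]]_(n, r)) (Q2 : 'M[R[i]]_(n, n - r)) k :
  (forall k, A k \is hermsymmx) -> Bp A Q1 Q2 k \is hermsymmx.
Proof.
move=> hA; have /hermsymmxP AJ := hA k.
apply/hermsymmxP; rewrite /Bp tr_block_mx map_block_mx !trmxC_mul !trmxCK AJ.
by rewrite !mulmxA trmx0 map_mx0.
Qed.

(** Apart from the zero block, a Hermitian [r]-by-[r] block and a complex [r]-by-[(n - r)] block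
    determine the matrix. *)
Lemma lin_indep_Bp_card n m l (A : 'I_(m + l) -> 'M[R[i]]_n) r
    (Q1 : 'M[R[i]]_(n, r)) (Q2 : 'M[R[i]]_(n, n - r)) (K : {set 'I_(m + l)}) :
    (forall k, A k \is hermsymmx) -> lin_indep K (Bp A Q1 Q2) ->
  (#|K| <= r * r + (r * (n - r) + r * (n - r)))%N.
Proof.
move=> hA.
(* The real parts on and above the diagonal together with the imaginary parts
   below it are coordinates of a Hermitian [r]-by-[r] block. *)
pose J := ('I_r * 'I_r + ('I_r * 'I_(n - r) + 'I_r * 'I_(n - r)))%type.
pose e k (j : J) : R :=
  let B := Bp A Q1 Q2 k in
  match j with
  | inl (i, j) => let z := B (lshift _ i) (lshift _ j) in
      if (i <= j)%N then complex.Re z else complex.Im z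
  | inr (inl (i, j)) => complex.Re (B (lshift _ i) (rshift _ j))
  | inr (inr (i, j)) => complex.Im (B (lshift _ i) (rshift _ j))
  end.
have <- : #|{: J}| = (r * r + (r * (n - r) + r * (n - r)))%N.
  by rewrite !card_sum !card_prod !card_ord.
apply: (lin_indep_card (e := e)) => c e0.
set S := \sum_(k in K) _.
have Sherm : S \is hermsymmx by apply: sum_real_herm => k; exact: Bp_herm.
have ReS i j : complex.Re (S i j) = \sum_(k in K) c k * complex.Re (Bp A Q1 Q2 k i j).
  by rewrite summxE Re_sum; apply: eq_bigr => k _; rewrite mxE Re_mul_real.
have ImS i j : complex.Im (S i j) = \sum_(k in K) c k * complex.Im (Bp A Q1 Q2 k i j).
  by rewrite summxE Im_sum; apply: eq_bigr => k _; rewrite mxE Im_mul_real.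
have ReJ i j : complex.Re (S i j) = complex.Re (S j i).
  by rewrite -(hermsymmx_entry j i Sherm) Re_conjC.
have ImJ i j : complex.Im (S i j) = - complex.Im (S j i).
  by rewrite -(hermsymmx_entry j i Sherm) Im_conjC.
have Re_ul (i j : 'I_r) : (i <= j)%N -> complex.Re (S (lshift _ i) (lshift _ j)) = 0.
  by move=> ij; have := e0 (inl (i, j)); rewrite /= ij -ReS.
have Im_ul (i j : 'I_r) : (j < i)%N -> complex.Im (S (lshift _ i) (lshift _ j)) = 0.
  by move=> ji; have := e0 (inl (i, j)); rewrite /= leqNgt ji /= -ImS.
have S_ur (i : 'I_r) (j : 'I_(n - r)) : S (lshift _ i) (rshift _ j) = 0.
  apply: complex_eq0; first by rewrite ReS; exact: (e0 (inr (inl (i, j)))).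
  by rewrite ImS; exact: (e0 (inr (inr (i, j)))).
apply/matrixP => i' j'; rewrite [RHS]mxE.
case: (split_ordP i') => i ->; case: (split_ordP j') => j ->.
- apply: complex_eq0.
    by case: (leqP i j) => [/Re_ul//|/ltnW/Re_ul ji0]; rewrite ReJ.
  (* On the diagonal the imaginary part equals its own opposite. *)
  case: (ltngtP i j) => [/Im_ul|/Im_ul//|/ord_inj ->].
    by move=> ji0; rewrite ImJ ji0 oppr0.
  by apply/eqP; rewrite -eqNr -ImJ.
- exact: S_ur.
- by rewrite -(hermsymmx_entry _ _ Sherm) S_ur rmorph0.
- by rewrite summxE big1// => k _; rewrite mxE block_mxEdr mxE mulr0.
Qed.

End NondegeneracyCount.

(** * Common rank of the primal optimal solutions and its lower bound *)

Theorem theorem2 (R : realType) (n m l : nat) (hn : (1 <= n)%N)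
  (C : 'M[R[i]]_n) (A : 'I_(m + l) -> 'M[R[i]]_n) (b : 'cV[R]_(m + l))
  (hC : C \is hermsymmx) (hA : forall k, A k \is hermsymmx)
  (hslater : slater C A b)
  (hsc : forall X y, primal_optimal C A b X -> dual_optimal C A b y ->
     strict_complementary C A X y)
  (hindep : lin_indep eq_idx A)
  (X0 : 'M[R[i]]_n) (hX0 : primal_optimal C A b X0)
  (hnd : primal_nondegenerate A b X0)
  (hcard : (2 * n <= m + #|active A b X0|)%N) :
  forall X : 'M[R[i]]_n, primal_optimal C A b X -> (1 < \rank X)%N.
Proof.
move=> X hX.
have [y hy] := dual_optimal_exists hC hA hindep hslater.
have -> : \rank X = \rank X0.
  by apply: (@addIn (\rank (slack C A y))); rewrite (hsc X y) ?(hsc X0 y).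
have [r [Q1 [Q2 [lam [rankX0 _ indep]]]]] := hnd.
have r_le_n : (r <= n)%N by rewrite -rankX0 rank_leq_row.
have := lin_indep_Bp_card hA indep.
have -> : #|(eq_idx :|: active A b X0)%SET| = (m + #|active A b X0|)%N.
  rewrite cardsU (_ : (_ :&: _)%SET = finset.set0); last first.
    by apply/setP => k; rewrite !inE; case: ltnP.
  rewrite cards0 subn0; congr (_ + _)%N.
  rewrite -[RHS]card_ord -(card_imset _ (@lshift_inj m l)).
  apply: eq_card => k; rewrite inE; apply/idP/imsetP => [km|[i _ ->]].
    by exists (Ordinal km) => //; apply: val_inj.
  by rewrite /= ltn_ord.
rewrite rankX0 => /(leq_trans hcard).
(* The count would give [2 * n <= 0] for [r = 0] and [2 * n <= 1 + 2 * (n - 1)] for [r = 1], both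
   impossible as [n >= 1]. *)
case: r {Q1 Q2 lam rankX0 indep} r_le_n => [|[|r]] //.
  by rewrite !mul0n !addn0 leqn0 muln_eq0 (gtn_eqF hn).
by rewrite !mul1n add1n addnn mul2n -(subnK hn) addnK addn1 doubleS ltnn.
Qed.
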